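(* For every fixed $\epsilon>0$ there exists $d_0=d_0(\epsilon)$ such that for every fixed integer $d\ge d_0$, asymptotically almost surely $G\in\mathcal{G}_{n,d}$ contains no $q$-bipartite hole with $q\ge(1+\epsilon)\frac{2n\log d}{d}$. As a consequence, a.a.s. \[ Z(G)\ge n\left(1-(1+\epsilon)\frac{4\log d}{d}\right). \]
   Context: $\mathcal{G}_{n,d}$ denotes the uniform probability space of (simple) $d$-regular graphs on $n$ labelled vertices, with $d$ fixed, $n\to\infty$, and $n$ even if $d$ is odd; a.a.s. means with probability tending to $1$ as $n\to\infty$. $\log$ is the natural logarithm. A $q$-bipartite hole in a graph is a pair of disjoint vertex sets $A_1,A_2$ with $|A_1|=|A_2|=q$ such that there is no edge with one end in $A_1$ and the other in $A_2$. Zero forcing: starting from a set of black vertices (others white), repeatedly a black vertex with exactly one white neighbour forces that neighbour to become black; a zero forcing set is one from which all vertices eventually become black, and $Z(G)$ is the minimum size of a zero forcing set. *)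

(* Defs.v *)
From mathcomp Require Import all_boot.
From Stdlib Require Import Reals.

Set Implicit Arguments.
Unset Strict Implicit.
Unset Printing Implicit Defensive.

(* A graph on the labelled vertex set 'I_n is its set of ordered adjacent
   pairs; simple graphs = symmetric irreflexive such sets (bijective with
   simple graphs on n labelled vertices). *)
Definition graph (n : nat) := {set ('I_n * 'I_n)}.

Definition adj n (G : graph n) (u v : 'I_n) : bool := (u, v) \in G.

Definition simpleb n (G : graph n) : bool :=
  [forall u : 'I_n, ~~ adj G u u] &&
  [forall u : 'I_n, forall v : 'I_n, adj G u v == adj G v u].

Definition nbhd n (G : graph n) (v : 'I_n) : {set 'I_n} := [set w | adj G v w].

Definition regularb n (d : nat) (G : graph n) : bool :=
  [forall v : 'I_n, #|nbhd G v| == d].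

Definition Gnd (n d : nat) : {set graph n} :=
  [set G : graph n | simpleb G && regularb d G].

(* a.a.s. for G uniform in G_{n,d} (d fixed, n -> oo, n*d even):
   for every delta > 0, for all large admissible n, the property P holds on
   an event of probability at least 1 - delta, i.e. on a set S of d-regular
   graphs with #|S| >= (1 - delta) * #|G_{n,d}|. *)
Definition aas (d : nat) (P : forall n : nat, graph n -> Prop) : Prop :=
  forall delta : R, (0 < delta)%R ->
  exists N : nat, forall n : nat, (N <= n)%N -> ~~ odd (n * d) ->
    exists S : {set graph n},
      S \subset Gnd n d /\
      ((1 - delta) * INR #|Gnd n d| <= INR #|S|)%R /\
      (forall G, G \in S -> P n G).

Definition bip_hole n (G : graph n) (q : nat) : Prop :=
  exists A1 A2 : {set 'I_n},
    [disjoint A1 & A2] /\ #|A1| = q /\ #|A2| = q /\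
    (forall u v, u \in A1 -> v \in A2 -> ~~ adj G u v).

(* Zero forcing: black sets reachable from B by successive single forces
   (a black vertex v whose only white neighbour is w forces w). *)
Inductive zf_reach n (G : graph n) (B : {set 'I_n}) : {set 'I_n} -> Prop :=
  | zf_refl : zf_reach G B B
  | zf_force S v w : zf_reach G B S -> v \in S ->
      nbhd G v :\: S = [set w] -> zf_reach G B (w |: S).

Definition zero_forcing_set n (G : graph n) (B : {set 'I_n}) : Prop :=
  zf_reach G B [set: 'I_n].

Definition Z_ge n (G : graph n) (m : R) : Prop :=
  forall B, zero_forcing_set G B -> (m <= INR #|B|)%R.

(* Main.v *)
(* Fix disjoint [A], [B] of size [q], and let [N_k] count the d-regular graphs
   with exactly [k] edges between [A] and [B]. Replacing edges [ax], [by] with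
   [a] in [A], [b] in [B] by [ab], [xy] creates one or two crossing edges, and
   double counting these switchings gives
     N_k (dq-k) (dq-k-3d^2) <= N_{k+1} (k+1) dn + N_{k+2} (k+2) (k+1).
   Iterating up to a [K] slightly below the mean [d q^2 / n] yields
   [N_0 <= |G_{n,d}| (K+1)! / K^(K+1)], which is [|G_{n,d}| e^{-K}] up to a
   factor linear in [K]. For [q] about [(1+eps) 2n log d / d] this beats the
   at most [(e d)^(2q)] choices of [(A, B)].

   If [B] is zero forcing and [|B| + 2q <= n], then the first [q] forcing
   vertices and the [>= q] vertices still white at that time form a bipartite
   hole; the difference between [eps/2] and [eps] absorbs the rounding of [q]. *)

Require Import Defs.
From mathcomp Require Import zify.
From Stdlib Require Import ZArith Reals Lra Lia.
From mathcomp Require Import all_boot.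

Set Implicit Arguments.
Unset Strict Implicit.
Unset Printing Implicit Defensive.

(** * Zero forcing and bipartite holes *)

Lemma subset_card_ex (T : finType) (A : {set T}) q : q <= #|A| ->
  exists2 C : {set T}, C \subset A & #|C| = q.
Proof.
elim: q => [|q IH] qA; first by exists set0; rewrite ?sub0set ?cards0.
have [C CA cC] := IH (ltnW qA).
have /card_gt0P[x]: 0 < #|A :\: C| by rewrite cardsDS // cC subn_gt0.
rewrite inE => /andP[xC xA]; exists (x |: C); last by rewrite cardsU1 xC cC.
by rewrite subUset sub1set xA.
Qed.

Section ZeroForcing.
Variables (n : nat) (G : graph n) (B : {set 'I_n}).

Lemma force_white S v w : nbhd G v :\: S = [set w] -> w \notin S.
Proof. by move/setP/(_ w); rewrite !inE eqxx; case/andP. Qed.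

(** Each force adds exactly one vertex, so the process passes through every intermediate size. *)
Lemma zf_reach_prefix S m : zf_reach G B S -> #|B| <= m <= #|S| ->
  exists2 S', zf_reach G B S' & #|S'| = m.
Proof.
elim=> [|{}S v w RS IH vS eqw].
  by rewrite -eqn_leq => /eqP <-; exists B => //; constructor.
rewrite cardsU1 (force_white eqw) add1n => /andP[Bm].
rewrite leq_eqVlt => /predU1P[->|mS]; last by apply: IH; rewrite Bm.
exists (w |: S); last by rewrite cardsU1 (force_white eqw).
exact: zf_force eqw.
Qed.

(* The vertices that have already forced have no white neighbour left. *)
Lemma zf_reach_forcers S : zf_reach G B S ->
  exists A : {set 'I_n}, [/\ A \subset S, #|A| + #|B| = #|S|
    & forall v, v \in A -> nbhd G v \subset S].
Proof.
elim=> [|{}S v w RS [A [AS cA nA]] vS eqw].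
  by exists set0; split; rewrite ?sub0set ?cards0 // => v; rewrite inE.
have wS := force_white eqw.
have vw : w \in nbhd G v by have /setP/(_ w) := eqw; rewrite !inE eqxx wS.
(* Vertices of [A] have no neighbour outside [S], so the vertex that now forces has not forced
   before. *)
have vA : v \notin A by apply/negP => /nA /subsetP /(_ w vw); rewrite (negPf wS).
exists (v |: A); split.
- by rewrite subUset sub1set !inE vS orbT (subset_trans AS) ?subsetUr.
- by rewrite !cardsU1 vA wS -cA addnA.
- move=> u /setU1P[->|/nA uS]; last by rewrite (subset_trans uS) ?subsetUr.
  by rewrite setUC -subDset eqw.
Qed.

Lemma zero_forcing_bip_hole q :
  zero_forcing_set G B -> #|B| + q.*2 <= n -> bip_hole G q.
Proof.
move=> ZB Bq; have [|S RS cS] := @zf_reach_prefix _ (#|B| + q) ZB.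
  by rewrite leq_addr cardsT card_ord -addnn in Bq *; lia.
have [A [AS cA nA]] := zf_reach_forcers RS.
have [|C CS cC] := @subset_card_ex _ (~: S) q.
  by rewrite cardsCs setCK card_ord; lia.
exists A, C; split; last split; [|by lia|split=> // u v uA vC].
  by rewrite disjoint_sym disjoints_subset (subset_trans CS) // setCS.
apply/negP => uv; have /subsetP/(_ v) := nA u uA; rewrite inE uv => /(_ isT).
by apply/negP; have /subsetP/(_ v vC) := CS; rewrite inE.
Qed.

End ZeroForcing.

(** Holes shrink, so excluding the least size above a threshold excludes all larger sizes. *)
Lemma bip_hole_leq n (G : graph n) q q' : q <= q' -> bip_hole G q' -> bip_hole G q.
Proof.
move=> qq' [A [B [dAB [cA [cB AB]]]]].
have [|A' A'A cA'] := @subset_card_ex _ A q; first by rewrite cA.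
have [|B' B'B cB'] := @subset_card_ex _ B q; first by rewrite cB.
exists A', B'; split; first exact: disjointW dAB.
by split=> //; split=> // u v /(subsetP A'A) uA /(subsetP B'B) vB; apply: AB.
Qed.

(** * Switchings *)

Lemma swap_pair_inj (T : Type) : injective (fun p : T * T => (p.2, p.1)).
Proof. by move=> [u v] [u' v'] [-> ->]. Qed.

Section SetOfPairs.
Variables T1 T2 : finType.

Lemma card_sigma_set (A : {set T1}) (B : T1 -> {set T2}) :
  #|[set p : T1 * T2 | (p.1 \in A) && (p.2 \in B p.1)]| = \sum_(x in A) #|B x|.
Proof.
rewrite -sum1_card (eq_bigl (fun p => (p.1 \in A) && (p.2 \in B p.1))); last first.
  by move=> p; rewrite inE.
rewrite -(pair_big_dep (mem A) (fun x y => y \in B x) (fun _ _ => 1)) /=.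
by apply: eq_bigr => x _; rewrite sum1_card.
Qed.

Lemma card_sigma_set_const (A : {set T1}) (B : T1 -> {set T2}) m :
  (forall x, x \in A -> #|B x| = m) ->
  #|[set p : T1 * T2 | (p.1 \in A) && (p.2 \in B p.1)]| = #|A| * m.
Proof.
by move=> Bm; rewrite card_sigma_set (eq_bigr (fun=> m)) ?sum_nat_const.
Qed.

End SetOfPairs.

(** * Edge counts in a regular graph *)

Section RegularGraph.
Variables (n d : nat) (G : graph n).
Hypothesis GG : G \in Gnd n d.

Lemma Gnd_sym u v : ((u, v) \in G) = ((v, u) \in G).
Proof.
move: GG; rewrite inE => /andP[/andP[_ /forallP/(_ u)/forallP/(_ v)/eqP]].
by rewrite /adj.
Qed.

Lemma Gnd_irr u : ((u, u) \in G) = false.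
Proof.
by move: GG; rewrite inE => /andP[/andP[/forallP/(_ u)/negPf]]; rewrite /adj.
Qed.

Lemma Gnd_neq u v : (u, v) \in G -> u != v.
Proof. by apply: contraTneq => ->; rewrite Gnd_irr. Qed.

Lemma Gnd_deg v : #|nbhd G v| = d.
Proof. by move: GG; rewrite inE => /andP[_ /forallP/(_ v)/eqP]. Qed.

Lemma card_edges_from (U : {set 'I_n}) : #|[set p in G | p.1 \in U]| = #|U| * d.
Proof.
rewrite -(@card_sigma_set_const _ _ U (nbhd G)) => [|v _]; last exact: Gnd_deg.
by apply: eq_card => -[u v]; rewrite !inE andbC.
Qed.

Lemma card_edges_to (U : {set 'I_n}) : #|[set p in G | p.2 \in U]| = #|U| * d.
Proof.
rewrite -card_edges_from -[RHS](card_imset _ (@swap_pair_inj _)).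
apply: eq_card => -[u v]; apply/idP/imsetP.
  by rewrite !inE /= => uvG; exists (v, u); rewrite ?inE //= Gnd_sym.
by case=> -[v' u']; rewrite !inE /= => vuG [-> ->]; rewrite Gnd_sym.
Qed.

Lemma card_Gnd_edges : #|G| = n * d.
Proof.
rewrite -[in RHS](card_ord n) -cardsT -card_edges_from.
by apply: eq_card => p; rewrite !inE andbT.
Qed.

End RegularGraph.

(** Equality of the unordered pairs [{u, v}] and [{a, b}]: a graph stores both orientations of an
    edge, so an edge operation must treat both. *)
Definition is_pair (T : eqType) (u v a b : T) :=
  (u == a) && (v == b) || (u == b) && (v == a).

Lemma is_pairC (T : eqType) (u v a b : T) : is_pair u v a b = is_pair u v b a.
Proof. exact: orbC. Qed.

Lemma is_pair_sym (T : eqType) (u v a b : T) : is_pair u v a b = is_pair v u a b.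
Proof. by rewrite /is_pair orbC andbC [(u == a) && _]andbC. Qed.

Section Switch.
Variables (n d : nat).
Implicit Types (G : graph n) (a x b y u v : 'I_n).

Definition switch G a x b y : graph n :=
  [set p | (p \in G) && ~~ is_pair p.1 p.2 a x && ~~ is_pair p.1 p.2 b y
           || is_pair p.1 p.2 a b || is_pair p.1 p.2 x y].

Lemma in_switch G a x b y u v : ((u, v) \in switch G a x b y) =
  ((u, v) \in G) && ~~ is_pair u v a x && ~~ is_pair u v b y
  || is_pair u v a b || is_pair u v x y.
Proof. by rewrite inE. Qed.

(** This symmetry and the next one can bring each of [x], [b], [y] into the place of [a], so among
    the four endpoints only the degree of [a] needs a computation. *)
Lemma switch_edges_swap G a x b y : switch G a x b y = switch G b y a x.
Proof.
apply/setP=> -[u v].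
by rewrite !in_switch (is_pairC _ _ b a) (is_pairC _ _ y x) andbAC.
Qed.

Lemma switch_flip G a x b y : switch G a x b y = switch G x a y b.
Proof.
apply/setP=> -[u v].
by rewrite !in_switch (is_pairC _ _ x a) (is_pairC _ _ y b) orbAC.
Qed.

(** In a simple graph the two edges also give [a != x] and [b != y], so all four vertices are
    distinct. *)
Definition switchable G a x b y := [&& (a, x) \in G, (b, y) \in G,
  (a, b) \notin G, (x, y) \notin G & [&& a != b, x != y, a != y & x != b]].

Lemma switchable_edges_swap G a x b y : G \in Gnd n d ->
  switchable G a x b y = switchable G b y a x.
Proof.
move=> GG; rewrite /switchable (Gnd_sym GG a b) (Gnd_sym GG x y).
rewrite (eq_sym a b) (eq_sym x y) (eq_sym a y) (eq_sym x b).
by do !case: (_ \in _) => //=; do !case: (_ == _).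
Qed.

Lemma switchable_flip G a x b y : G \in Gnd n d ->
  switchable G a x b y = switchable G x a y b.
Proof.
move=> GG; rewrite /switchable (Gnd_sym GG a x) (Gnd_sym GG b y).
by do !case: (_ \in _) => //=; do !case: (_ == _).
Qed.

Lemma switch_deg_end G a x b y : G \in Gnd n d -> switchable G a x b y ->
  #|nbhd (switch G a x b y) a| = d.
Proof.
move=> GG /and5P[ax bY ab xy /and4P[Nab Nxy Nay Nxb]].
have Nax := Gnd_neq GG ax.
have ->: nbhd (switch G a x b y) a = b |: (nbhd G a :\ x).
  apply/setP=> v; rewrite !inE /adj in_switch /is_pair eqxx.
  rewrite (negPf Nab) (negPf Nay) (negPf Nax) /= !orbF !andbT.
  by rewrite andbC orbC.
rewrite cardsU1 !inE /adj (negPf ab) andbF add1n.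
by rewrite -(Gnd_deg GG a) [in RHS](cardsD1 x) inE /adj ax.
Qed.

Lemma switch_Gnd G a x b y : G \in Gnd n d -> switchable G a x b y ->
  switch G a x b y \in Gnd n d.
Proof.
move=> GG sw; have /and5P[ax bY ab xy /and4P[Nab Nxy Nay Nxb]] := sw.
rewrite inE; apply/andP; split; [apply/andP; split|]; apply/forallP => u.
- rewrite /adj in_switch (Gnd_irr GG) /= /is_pair; apply/norP; split.
    by apply/negP => /orP[]/andP[/eqP-> /eqP E]; move: Nab; rewrite E eqxx.
  by apply/negP => /orP[]/andP[/eqP-> /eqP E]; move: Nxy; rewrite E eqxx.
- apply/forallP => v; rewrite /adj !in_switch (Gnd_sym GG u v).
  by rewrite !(is_pair_sym u v).
- have [->|ua] := eqVneq u a; first by rewrite switch_deg_end.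
  have [->|ux] := eqVneq u x.
    by rewrite switch_flip switch_deg_end // -switchable_flip.
  have [->|ub] := eqVneq u b.
    by rewrite switch_edges_swap switch_deg_end // -switchable_edges_swap.
  have [->|uy] := eqVneq u y.
    rewrite switch_edges_swap switch_flip switch_deg_end //.
    by rewrite -switchable_flip // -switchable_edges_swap.
  rewrite -(Gnd_deg GG u); apply/eqP/eq_card => v.
  rewrite !inE /adj in_switch /is_pair.
  by rewrite (negPf ua) (negPf ux) (negPf ub) (negPf uy) /= !orbF !andbT.
Qed.

(** Off the pairs [ax], [by], [ab], [xy] a switch changes nothing, and on them [switchable]
    prescribes membership in both graphs. *)
Lemma switch_inj G H a x b y : G \in Gnd n d -> H \in Gnd n d ->
  switchable G a x b y -> switchable H a x b y ->
  switch G a x b y = switch H a x b y -> G = H.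
Proof.
move=> GG HH /and5P[axG bYG abG xyG _] /and5P[axH bYH abH xyH _] /setP eGH.
apply/setP=> -[u v]; have := eGH (u, v); rewrite !in_switch.
have eq_pair a' b' : ((a', b') \in G) = ((a', b') \in H) -> is_pair u v a' b' ->
    ((u, v) \in G) = ((u, v) \in H).
  move=> E /orP[]/andP[/eqP-> /eqP->] //.
  by rewrite (Gnd_sym GG) (Gnd_sym HH).
have [/eq_pair->//|_] := boolP (is_pair u v a x); first by rewrite axG axH.
have [/eq_pair->//|_] := boolP (is_pair u v b y); first by rewrite bYG bYH.
have [/eq_pair->//|_] := boolP (is_pair u v a b).
  by rewrite (negPf abG) (negPf abH).
have [/eq_pair->//|_] := boolP (is_pair u v x y).
  by rewrite (negPf xyG) (negPf xyH).
by rewrite /= !orbF !andbT.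
Qed.

End Switch.

(** * Double counting of switchings by the number of crossing edges *)

Section SwitchCounting.
Variables (n d q : nat) (A B : {set 'I_n}).
Hypotheses (dAB : [disjoint A & B]) (cA : #|A| = q) (cB : #|B| = q).
Implicit Types (G H : graph n).

(** For disjoint [C] and [D] each edge between them is counted once, in its orientation from [C] to
    [D]. *)
Definition cross (C D : {set 'I_n}) G : {set 'I_n * 'I_n} :=
  [set p in G | (p.1 \in C) && (p.2 \in D)].

Definition cross_class k : {set graph n} :=
  [set G in Gnd n d | #|cross A B G| == k].

Lemma card_cross_sym C D G : G \in Gnd n d -> #|cross C D G| = #|cross D C G|.
Proof.
move=> GG; rewrite -(card_imset _ (@swap_pair_inj _)); apply: eq_card => -[u v].
apply/imsetP/idP => [[[v' u']]|].
  by rewrite !inE /= => /and3P[vu vC uD] [-> ->]; rewrite (Gnd_sym GG) vu vC uD.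
rewrite inE /= => /and3P[uv uD vC].
by exists (v, u); rewrite ?inE //= (Gnd_sym GG) uv uD vC.
Qed.

Lemma card_cross_compl C D G : G \in Gnd n d ->
  #|cross C (~: D) G| = #|C| * d - #|cross C D G|.
Proof.
move=> GG; rewrite -(card_edges_from GG).
rewrite -(cardsID [set p | p.2 \in D] [set p in G | p.1 \in C]).
have ->: [set p in G | p.1 \in C] :&: [set p | p.2 \in D] = cross C D G.
  by apply/setP=> p; rewrite !inE andbA.
have ->: [set p in G | p.1 \in C] :\: [set p | p.2 \in D] = cross C (~: D) G.
  by apply/setP=> p; rewrite !inE andbC andbA.
by rewrite addKn.
Qed.

Definition quad := (('I_n * 'I_n) * ('I_n * 'I_n))%type.

(* A move [((a, x), (b, y))] replaces the edges [ax], [by] with [ab], [xy];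
   it creates one crossing edge, or two if [x \in A] and [y \in B]. *)
Definition moves G : {set quad} :=
  [set t | [&& switchable G t.1.1 t.1.2 t.2.1 t.2.2,
               t.1.1 \in A, t.1.2 \notin B, t.2.1 \in B & t.2.2 \notin A]].

Lemma card_moves_ge k G : G \in cross_class k ->
  (q * d - k) * (q * d - k - 3 * (d * d)) <= #|moves G|.
Proof.
rewrite inE => /andP[GG /eqP ck].
(* Given [p = (a, x)], the edges [by] to avoid are the [d * d] ones with [b] adjacent to [a] and the
   [(d + 1) * d] ones with [y] equal or adjacent to [x]. *)
pose bad (p : 'I_n * 'I_n) : {set 'I_n * 'I_n} :=
  [set r in G | r.1 \in nbhd G p.1] :|: [set r in G | r.2 \in p.2 |: nbhd G p.2].
have card_bad p : #|bad p| <= 3 * (d * d).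
  rewrite (leq_trans (leq_card_setU _ _)) // (card_edges_from GG) (card_edges_to GG).
  rewrite cardsU1 !(Gnd_deg GG).
  by case: (_ \notin _); nia.
pose E1 := cross A (~: B) G; pose E2 := cross B (~: A) G.
have cE1 : #|E1| = q * d - k by rewrite card_cross_compl // cA ck.
have cE2 : #|E2| = q * d - k by rewrite card_cross_compl // cB card_cross_sym // ck.
apply: (@leq_trans #|[set t : quad | (t.1 \in E1) && (t.2 \in E2 :\: bad t.1)]|).
  rewrite (card_sigma_set E1 (fun p => E2 :\: bad p)) -cE1 -sum_nat_const.
  apply: leq_sum => p _.
  rewrite cardsD cE2 cE1 leq_sub2l // (leq_trans _ (card_bad p)) //.
  by rewrite subset_leq_card ?subsetIr.
apply/subset_leq_card/subsetP => -[[a x] [b y]].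
rewrite !inE /adj /= => /andP[/and3P[ax aA xB] /andP[]].
move=> + /and3P[bY bB yA]; rewrite bY /= negb_or => /andP[ab].
rewrite negb_or => /andP[yx xy].
rewrite /switchable ax bY ab xy aA bB xB yA (eq_sym x y) yx /= !andbT.
(* The other inequalities follow from the position of the vertices relative to [A] and [B]. *)
apply/and3P; split.
- by apply: contraTneq aA => ->; rewrite (disjointFl dAB).
- by apply: contraNneq yA => <-.
- by apply: contraNneq xB => ->.
Qed.

(** As [A] and [B] are disjoint, [x] is outside [B] and [y] outside [A], the removed edges do not
    cross, and [xy] can cross only with [x] in [A] and [y] in [B]. *)
Lemma cross_switch G a x b y : G \in Gnd n d ->
  ((a, x), (b, y)) \in moves G ->
  let X := (a, b) |: cross A B G in
  cross A B (switch G a x b y) =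
  if (x \in A) && (y \in B) then (x, y) |: X else X.
Proof.
move=> GG; rewrite inE /= => /and5P[sw aA xB bB yA] /=.
have bA := disjointFl dAB bB; have aB := disjointFr dAB aA.
have key u v : ((u, v) \in cross A B (switch G a x b y)) =
  ((u, v) \in (a, b) |: cross A B G) ||
  [&& x \in A, y \in B & (u, v) == (x, y)].
  rewrite in_setU1 ![_ \in cross _ _ _]inE in_switch /=.
  have [/andP[uA vB]|notAB] := boolP ((u \in A) && (v \in B)).
    have Nv w : w \notin B -> (v == w) = false.
      by move=> wB; apply: contraNF wB => /eqP <-.
    have Nu w : w \notin A -> (u == w) = false.
      by move=> wA; apply: contraNF wA => /eqP <-.
    rewrite /is_pair (Nv x) ?(Nv a) ?(Nu b) ?(Nu y) ?aB ?bA // !andbF !orbF /= !andbT.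
    rewrite !xpair_eqE [X in _ = X || _]orbC; congr (_ || _).
    have [<-|_] := eqVneq u x; last by rewrite !andbF.
    by have [<-|_] := eqVneq v y; rewrite ?andbF // uA vB.
  rewrite !andbF orbF; apply/esym/norP; split.
    by apply: contraNneq notAB => -[-> ->]; rewrite aA bB.
  by apply: contra notAB => /and3P[xA yB /eqP[-> ->]]; rewrite xA.
apply/setP=> -[u v]; rewrite key.
case: (x \in A); case: (y \in B); rewrite /= ?orbF ?in_setU1 //.
by rewrite orbC.
Qed.

Lemma card_cross_switch G a x b y k : G \in cross_class k ->
  ((a, x), (b, y)) \in moves G ->
  #|cross A B (switch G a x b y)| = if (x \in A) && (y \in B) then k.+2 else k.+1.
Proof.
rewrite inE => /andP[GG /eqP ck] mv; rewrite cross_switch //.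
move: mv; rewrite inE /= => /andP[/and5P[ax bY ab xy _] _].
have abX : (a, b) \notin cross A B G by rewrite inE (negPf ab).
have xyX : (x, y) \notin (a, b) |: cross A B G.
  by rewrite !inE (negPf xy) orbF xpair_eqE (eq_sym x) (negPf (Gnd_neq GG ax)).
by case: ifP => _; rewrite ?cardsU1 ?xyX abX ck.
Qed.

(** A move and its source are recovered from the switched graph and the created pairs [ab], [xy]. In
    class [k.+1] there are [k.+1] choices for [ab] and at most [n * d] for the oriented [xy]; in
    class [k.+2] both are crossing edges, and distinct. *)
Lemma card_moves_le k :
  \sum_(G in cross_class k) #|moves G| <=
  #|cross_class k.+1| * (k.+1 * (n * d)) + #|cross_class k.+2| * (k.+2 * k.+1).
Proof.
rewrite -card_sigma_set; set W := [set p | _].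
pose R1 H : {set quad} := [set t | (t.1 \in cross A B H) && (t.2 \in H)].
pose R2 H : {set quad} :=
  [set t | (t.1 \in cross A B H) && (t.2 \in cross A B H :\ t.1)].
rewrite -(card_sigma_set_const (B := R1)); last first.
  move=> G; rewrite inE => /andP[GG /eqP <-].
  by apply: (card_sigma_set_const (B := fun=> G)) => _ _; apply: card_Gnd_edges.
rewrite -(card_sigma_set_const (B := R2)); last first.
  move=> G; rewrite inE => /andP[GG /eqP cX]; rewrite -{1}cX.
  apply: (card_sigma_set_const (B := fun p => cross A B G :\ p)) => p pX.
  by move: cX; rewrite (cardsD1 p) pX add1n => -[].
pose f (p : graph n * quad) := let: (G, ((a, x), (b, y))) := p in
  (switch G a x b y, ((a, b), (x, y))).
apply: leq_trans (leq_card_setU _ _).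
have inW G t : (G, t) \in W -> [/\ G \in cross_class k, G \in Gnd n d & t \in moves G].
  by rewrite inE => /andP[GC mv]; split=> //; move: GC; rewrite inE => /andP[].
have f_inj : {in W &, injective f}.
  move=> [G [[a x] [b y]]] [H [[a' x'] [b' y']]] /inW[_ GG mvG] /inW[_ HH mvH].
  case=> E Ea Eb Ex Ey; subst a' b' x' y'.
  move: mvG mvH; rewrite !inE /= => /andP[swG _] /andP[swH _].
  by rewrite (switch_inj GG HH swG swH E).
rewrite -(card_in_imset f_inj); apply/subset_leq_card/subsetP => p.
case/imsetP=> -[G [[a x] [b y]]] /inW[GC GG mv] -> /=.
have cX := card_cross_switch GC mv.
have := mv; rewrite inE /= => /and5P[sw aA xB bB yA].
have := sw => /and5P[ax bY ab xy /and4P[Nab Nxy Nay Nxb]].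
set H := switch G a x b y in cX *.
have abH : (a, b) \in cross A B H.
  by rewrite inE aA bB in_switch /is_pair !eqxx !orbT.
have xyH : (x, y) \in H by rewrite in_switch /is_pair !eqxx !orbT.
have HH : H \in Gnd n d := switch_Gnd GG sw.
apply/setUP; case: ifP cX => [/andP[xA yB]|_] cX; [right|left].
  rewrite in_set /= [H \in _]in_set HH cX eqxx in_set /= abH in_setD1 inE xyH xA yB.
  by rewrite xpair_eqE (eq_sym x) (negPf (Gnd_neq GG ax)).
by rewrite in_set /= [H \in _]in_set HH cX eqxx in_set /= abH.
Qed.

End SwitchCounting.

(** * Factorials and exponentials *)

Section RealEstimates.
Local Open Scope R_scope.

Lemma INR_addn m n : INR (m + n)%N = INR m + INR n.
Proof. exact: plus_INR. Qed.

Lemma INR_muln m n : INR (m * n)%N = INR m * INR n.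
Proof. exact: mult_INR. Qed.

Lemma INR_leq m n : (m <= n)%N -> INR m <= INR n.
Proof. by move/leP/le_INR. Qed.

Lemma leq_INR m n : INR m <= INR n -> (m <= n)%N.
Proof. by move/INR_le/leP. Qed.

Lemma fact_gt0R k : 0 < INR k`!.
Proof. by apply/lt_0_INR/ltP/fact_gt0. Qed.

(* With [b k = N k * k! / K^k], the hypothesis bounds [b k] by a convex
   combination of [b k.+1] and [b k.+2]. *)
Lemma switching_chain (N : nat -> R) (D T : R) (K : nat) :
  (0 < K)%N -> 0 <= D -> (forall k, N k <= T) -> 0 <= T ->
  (forall k, (k < K)%N -> N k * (D * INR K + INR K * INR K) <=
     N k.+1 * (INR k.+1 * D) + N k.+2 * (INR k.+2 * INR k.+1)) ->
  N 0%N <= T * (INR K.+1`! / INR K ^ K.+1).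
Proof.
move=> K0 D0 NT T0 rec.
have x0 : 0 < INR K by apply/lt_0_INR/ltP.
set x := INR K in x0 rec *.
pose c k := INR k`! / x ^ k.
have xk k : 0 < x ^ k by apply: pow_lt.
have c0 k : 0 < c k.
  by apply: Rdiv_lt_0_compat => //; exact: fact_gt0R.
have cS k : c k.+1 * x = c k * INR k.+1.
  rewrite /c factS INR_muln /=; field.
  by split; [have := xk k|]; lra.
pose b k := N k * c k; pose M := T * c K.+1.
have bM k : (k < K)%N -> b k.+1 <= M -> b k.+2 <= M -> b k <= M.
  (* Multiplied by [c k], the recurrence reads [(D x + x^2) b k <= D x b k.+1 + x^2 b k.+2]. *)
  move=> kK h1 h2; have := rec k kK => /(Rmult_le_compat_l (c k) _ _ (Rlt_le _ _ (c0 k))) h.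
  have e1 : c k * (N k.+1 * (INR k.+1 * D)) = D * x * b k.+1.
    rewrite /b; replace (D * x * _) with (D * N k.+1 * (c k.+1 * x)) by ring.
    by rewrite cS; ring.
  have e2 : c k * (N k.+2 * (INR k.+2 * INR k.+1)) = x * x * b k.+2.
    rewrite /b; replace (x * x * _) with (N k.+2 * (c k.+2 * x) * x) by ring.
    rewrite cS; replace (N k.+2 * _ * _) with (N k.+2 * INR k.+2 * (c k.+1 * x)) by ring.
    by rewrite cS; ring.
  have e0 : c k * (N k * (D * x + x * x)) = (D * x + x * x) * b k by rewrite /b; ring.
  have h3 : D * x * b k.+1 <= D * x * M by apply: Rmult_le_compat_l => //; nra.
  have h4 : x * x * b k.+2 <= x * x * M by apply: Rmult_le_compat_l => //; nra.
  apply: (Rmult_le_reg_l (D * x + x * x)); nra.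
have bKS : b K.+1 <= M by apply: Rmult_le_compat_r => //; have := c0 K.+1; lra.
(* [c K <= c K.+1], their ratio being [(K + 1) / K]. *)
have bK : b K <= M.
  apply: (Rle_trans _ (T * c K)); first by apply: Rmult_le_compat_r => //; have := c0 K; lra.
  apply: Rmult_le_compat_l => //; apply: (Rmult_le_reg_r x) => //.
  rewrite cS S_INR -/x; have := c0 K; nra.
(* The recurrence has depth two, so the downward induction carries two consecutive bounds. *)
have down j : (j <= K)%N -> b (K - j)%N <= M /\ b (K - j).+1 <= M.
  elim: j => [|j IH] jK; first by rewrite subn0.
  have [h1 h2] := IH (ltnW jK).
  have E : (K - j.+1).+1 = (K - j)%N by rewrite subnSK.
  by rewrite E; split=> //; apply: bM; rewrite ?E //; lia.
have [+ _] := down K (leqnn K); rewrite subnn /b /M.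
have -> : c 0%N = 1 by rewrite /c fact0 /=; field.
by rewrite Rmult_1_r.
Qed.

Lemma exp_natmul k x : exp x ^ k = exp (INR k * x).
Proof.
elim: k => [|k IH]; first by rewrite Rmult_0_l exp_0.
by rewrite -tech_pow_Rmult IH -exp_plus S_INR; congr exp; ring.
Qed.

(** An upper Stirling bound; the induction step amounts to [(1 - 1/(k+1))^(k+1) <= 1/e]. *)
Lemma fact_exp_le K : (0 < K)%N -> INR K`! * exp (INR K) <= exp 1 * INR K ^ K.+1.
Proof.
elim: K => // -[_ _|K IH _]; first by rewrite factS fact0 /=; lra.
have {IH} := IH isT; set k := K.+1 => IH.
have k0 : 0 < INR k by apply/lt_0_INR/ltP.
rewrite factS INR_muln S_INR exp_plus -tech_pow_Rmult.
apply: (Rle_trans _ ((INR k + 1) * exp 1 * (exp 1 * INR k ^ k.+1))).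
  have := exp_pos 1 => e0; have : 0 < (INR k + 1) * exp 1 by nra.
  by move=> h; have := Rmult_le_compat_l _ _ _ (Rlt_le _ _ h) IH; lra.
suff h : exp 1 * INR k ^ k.+1 <= (INR k + 1) ^ k.+1.
  have := exp_pos 1 => e0; have : 0 < (INR k + 1) * exp 1 by nra.
  by move=> h'; have := Rmult_le_compat_l _ _ _ (Rlt_le _ _ h') h; lra.
pose r := INR k / (INR k + 1).
have r_le : r <= exp (- / (INR k + 1)).
  have := exp_ineq1_le (- / (INR k + 1)); rewrite /r => h.
  by replace (INR k / _) with (1 + - / (INR k + 1)) by (field; lra).
have r0 : 0 <= r by apply/Rlt_le/Rdiv_lt_0_compat; lra.
have := pow_incr _ _ k.+1 (conj r0 r_le).
rewrite exp_natmul S_INR.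
replace ((INR k + 1) * _) with (- 1) by (field; lra).
rewrite exp_Ropp.
replace (INR k ^ k.+1) with (r ^ k.+1 * (INR k + 1) ^ k.+1); last first.
  by rewrite -Rpow_mult_distr /r; congr (_ ^ _); field; lra.
have p0 : 0 < (INR k + 1) ^ k.+1 by apply: pow_lt; lra.
have e0 := exp_pos 1.
move=> /(Rmult_le_compat_l (exp 1 * (INR k + 1) ^ k.+1)) h.
have {h} := h (Rlt_le _ _ (Rmult_lt_0_compat _ _ e0 p0)).
replace (exp 1 * _ * / exp 1) with ((INR k + 1) ^ k.+1) by (field; lra).
lra.
Qed.

(** A lower Stirling bound; the induction step amounts to [(1 + 1/k)^k <= e], so the step from 0 is
    treated apart. *)
Lemma pow_le_fact_exp q : INR q ^ q <= INR q`! * exp (INR q).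
Proof.
elim: q => [|q IH]; first by rewrite fact0 /= exp_0; lra.
case: q IH => [_|K IH].
  by rewrite factS fact0 /=; have := exp_ineq1_le 1; lra.
set k := K.+1 in IH *.
have k0 : 0 < INR k by apply/lt_0_INR/ltP.
rewrite factS INR_muln S_INR exp_plus -tech_pow_Rmult.
suff h : (INR k + 1) ^ k <= exp 1 * INR k ^ k.
  have e0 := exp_pos 1.
  have := Rmult_le_compat_l (exp 1) _ _ (Rlt_le _ _ e0) IH => h'.
  have h2 : (INR k + 1) ^ k <= exp 1 * (INR k`! * exp (INR k)) by lra.
  have := Rmult_le_compat_l (INR k + 1) _ _ _ h2; lra.
have r_le : (INR k + 1) / INR k <= exp (/ INR k).
  have := exp_ineq1_le (/ INR k).
  by replace ((INR k + 1) / INR k) with (1 + / INR k) by (field; lra).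
have r0 : 0 <= (INR k + 1) / INR k by apply/Rlt_le/Rdiv_lt_0_compat; lra.
have := pow_incr _ _ k (conj r0 r_le).
rewrite exp_natmul Rinv_r; last lra.
move=> /(Rmult_le_compat_r (INR k ^ k)) h.
have {h} := h (Rlt_le _ _ (pow_lt _ _ k0)).
rewrite -Rpow_mult_distr.
by replace (_ / INR k * INR k) with (INR k + 1) by (field; lra).
Qed.

(** [exp x] is the square of [exp (x / 2)], which is at least [1 + x / 2]. *)
Lemma sqr_le_exp x : 0 <= x -> x * x <= 4 * exp x.
Proof.
move=> x0; replace x with (x / 2 + x / 2) at 3 by field.
rewrite exp_plus; have := exp_ineq1_le (x / 2); nra.
Qed.

Lemma INR_ffact_le n q : INR (n ^_ q) <= INR n ^ q.
Proof.
elim: q => [|q IH]; first by rewrite ffactn0 /=; lra.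
rewrite ffactnSr INR_muln -tech_pow_Rmult Rmult_comm.
apply: Rmult_le_compat => //; try exact: pos_INR.
by apply: INR_leq; exact: leq_subr.
Qed.

(** The binomial is at most [n^q / q! <= (q d)^q / q!], and [q^q / q! <= e^q]. *)
Lemma INR_bin_le n q d : (n <= q * d)%N ->
  INR 'C(n, q) <= exp (INR q) * INR d ^ q.
Proof.
move=> nqd; apply: (Rmult_le_reg_r _ _ _ (fact_gt0R q)).
rewrite -INR_muln bin_ffact; apply: (Rle_trans _ _ _ (INR_ffact_le n q)).
apply: (Rle_trans _ ((INR q * INR d) ^ q)).
  by apply: pow_incr; split; [exact: pos_INR|rewrite -INR_muln; exact: INR_leq].
rewrite Rpow_mult_distr.
have := Rmult_le_compat_r _ _ _ (pow_le _ q (pos_INR d)) (pow_le_fact_exp q).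
lra.
Qed.

End RealEstimates.

(** * Counting graphs with a hole *)

Lemma leq_card_bigcup (I T : finType) (P : {set I}) (F : I -> {set T}) m :
  (forall i, i \in P -> #|F i| <= m) -> #|\bigcup_(i in P) F i| <= #|P| * m.
Proof.
move=> Fm; rewrite -sum_nat_const.
apply: (big_ind2 (fun (X : {set T}) (k : nat) => #|X| <= k)) => [|X m1 Y m2 h1 h2|//].
  by rewrite cards0.
by rewrite (leq_trans (leq_card_setU _ _)) ?leq_add.
Qed.

Definition hole_pairs n q : {set {set 'I_n} * {set 'I_n}} :=
  [set p : {set 'I_n} * {set 'I_n} |
     [&& [disjoint p.1 & p.2], #|p.1| == q & #|p.2| == q]].

Definition hole_graphs n d q : {set graph n} :=
  \bigcup_(p in hole_pairs n q) cross_class d p.1 p.2 0.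

Lemma card_hole_pairs n q : #|hole_pairs n q| <= 'C(n, q) * 'C(n, q).
Proof.
have cD : #|[set A : {set 'I_n} | #|A| == q]| = 'C(n, q).
  by rewrite card_draws card_ord.
rewrite -[in leqRHS]cD -cardsX; apply/subset_leq_card/subsetP => -[A B].
by rewrite !inE => /and3P[_ -> ->].
Qed.

Lemma bip_hole_hole_graphs n d q (G : graph n) :
  G \in Gnd n d -> bip_hole G q -> G \in hole_graphs n d q.
Proof.
move=> GG [A [B [dAB [cA [cB AB]]]]]; apply/bigcupP; exists (A, B).
  by rewrite inE dAB cA cB eqxx.
rewrite inE GG cards_eq0; apply/eqP/setP => -[u v]; rewrite !inE.
by apply/negP => /and3P[uv uA vB]; move: (AB u v uA vB); rewrite /adj uv.
Qed.

Local Open Scope R_scope.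

(** The hypothesis on [K] bounds below the number of moves from each class [k < K], which gives the
    recurrence with [D = n d]. Then [(K+1)! / K^(K+1) <= (K + 1) e e^(-K)], and [K + 1 <= 2 K]. *)
Lemma cross_class0_le n d q K (A B : {set 'I_n}) :
  [disjoint A & B] -> #|A| = q -> #|B| = q -> (0 < K)%N ->
  (forall k, (k < K)%N ->
    K * (n * d) + K * K <= (q * d - k) * (q * d - k - 3 * (d * d)))%N ->
  INR #|cross_class d A B 0%N| <=
    INR #|Gnd n d| * (2 * exp 1 * INR K * exp (- INR K)).
Proof.
move=> dAB cA cB K0 FK.
have K0R : 0 < INR K by apply/lt_0_INR/ltP.
have T0 := pos_INR #|Gnd n d|.
have leT k : INR #|cross_class d A B k| <= INR #|Gnd n d|.
  by apply: INR_leq; apply/subset_leq_card/subsetP => G; rewrite inE => /andP[].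
apply: (Rle_trans _ (INR #|Gnd n d| * (INR K.+1`! / INR K ^ K.+1))).
  apply: (switching_chain (N := fun k => INR #|cross_class d A B k|)
            K0 (pos_INR (n * d)%N)) => // k kK.
  have := card_moves_le d dAB k.
  have /leq_sum h : forall G, G \in cross_class d A B k ->
      (K * (n * d) + K * K <= #|moves A B G|)%N.
    by move=> G GC; apply: leq_trans (FK k kK) (card_moves_ge dAB cA cB GC).
  move=> /(leq_trans (h _)); rewrite sum_nat_const => /INR_leq.
  rewrite INR_addn !INR_muln INR_addn !INR_muln; lra.
apply: Rmult_le_compat_l => //.
apply: (Rmult_le_reg_r (INR K ^ K.+1)); first exact: pow_lt.
replace (_ / _ * _) with (INR K.+1`!); last by field; apply/Rgt_not_eq/pow_lt.
rewrite factS INR_muln S_INR.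
have := fact_exp_le K0; have e0 := exp_pos (- INR K).
move=> /(Rmult_le_compat_l _ _ _ (Rlt_le _ _ e0)).
replace (exp (- INR K) * (INR K`! * exp (INR K))) with (INR K`!); last first.
  by rewrite exp_Ropp; field; apply/Rgt_not_eq/exp_pos.
move=> h; have K1 : 1 <= INR K by apply: (INR_leq K0).
have := Rmult_le_compat_l (INR K + 1) _ _ ltac:(lra) h => h'.
have p0 : 0 <= exp (- INR K) * (exp 1 * INR K ^ K.+1).
  apply: Rmult_le_pos; first lra.
  by apply: Rmult_le_pos; apply/Rlt_le; [exact: exp_pos|exact: pow_lt].
nra.
Qed.

Lemma card_hole_graphs_le n d q K : (0 < K)%N -> (n <= q * d)%N ->
  (forall k, (k < K)%N ->
    K * (n * d) + K * K <= (q * d - k) * (q * d - k - 3 * (d * d)))%N ->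
  INR #|hole_graphs n d q| <= INR #|Gnd n d| *
    ((exp (INR q) * INR d ^ q) ^ 2 * (2 * exp 1 * INR K * exp (- INR K))).
Proof.
move=> K0 nqd FK; set c := (2 * _ * _ * _).
have c0 : 0 <= c.
  rewrite /c; have := exp_pos 1; have := exp_pos (- INR K); have := pos_INR K => *.
  by do !apply: Rmult_le_pos; lra.
have T0 := pos_INR #|Gnd n d|.
set m := INR #|Gnd n d| * c.
have hm : INR #|hole_graphs n d q| <= INR #|hole_pairs n q| * m.
  (* The union bound takes a natural number, so [m] is replaced by the largest class size, which is
     at most [m]. *)
  have [M [Mm MX]] : exists M : nat, INR M <= m /\
     forall p, p \in hole_pairs n q -> (#|cross_class d p.1 p.2 0%N| <= M)%N.
    exists (\max_(p in hole_pairs n q) #|cross_class d p.1 p.2 0%N|); split; last first.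
      by move=> p pP; 
      exact: (@leq_bigmax_cond _ (fun p => p \in hole_pairs n q)
        (fun p => #|cross_class d p.1 p.2 0%N|) p pP).
    apply: (big_ind (fun x => INR x <= m)) => [|x y hx hy|p]; first exact: Rmult_le_pos.
      by rewrite /maxn; case: ifP.
    by rewrite inE => /and3P[dp /eqP c1 /eqP c2]; apply: cross_class0_le dp c1 c2 K0 FK.
  apply: (Rle_trans _ (INR (#|hole_pairs n q| * M)%N)).
    exact/INR_leq/leq_card_bigcup.
  by rewrite INR_muln; apply: Rmult_le_compat_l => //; exact: pos_INR.
apply: (Rle_trans _ _ _ hm); rewrite /m.
have b0 := pos_INR 'C(n, q); have bl := INR_bin_le nqd.
have := INR_leq (card_hole_pairs n q); rewrite INR_muln => hp.
replace (_ * (_ ^ 2 * c)) with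
  ((exp (INR q) * INR d ^ q) ^ 2 * (INR #|Gnd n d| * c)) by ring.
apply: Rmult_le_compat_r; first exact: Rmult_le_pos.
apply: (Rle_trans _ _ _ hp); rewrite /= Rmult_1_r.
by apply: Rmult_le_compat.
Qed.

(* The threshold [K] is slightly below the mean number [d q^2 / n] of crossing
   edges; the slack [eta] absorbs the loss [2 q / n + 3 d / q] in one switching. *)
Lemma switching_threshold (eta : R) n d q K :
  0 < eta <= 1 -> (0 < n)%N ->
  INR K * INR n <= (1 - eta) * INR d * INR q * INR q ->
  INR q <= eta / 4 * INR n -> 6 * INR d <= eta * INR q ->
  forall k, (k < K)%N ->
   (K * (n * d) + K * K <= (q * d - k) * (q * d - k - 3 * (d * d)))%N.
Proof.
move=> eta01 n0 Kn qn dq k kK.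
have nR : 0 < INR n by apply/lt_0_INR/ltP.
have [d0 [q0 K0]] := conj (pos_INR d) (conj (pos_INR q) (pos_INR K)).
have dq0 : 0 <= INR d * INR q by apply: Rmult_le_pos.
have K2 : INR K <= eta / 4 * (INR d * INR q).
  apply: (Rmult_le_reg_r (INR n)) => //; apply: (Rle_trans _ _ _ Kn).
  apply: (Rle_trans _ (INR d * INR q * INR q)).
    rewrite !Rmult_assoc; have : 0 <= INR d * (INR q * INR q) by nra.
    nra.
  by have := Rmult_le_compat_l _ _ _ dq0 qn; lra.
have d2 : 3 * (INR d * INR d) <= eta / 2 * (INR d * INR q).
  by have := Rmult_le_compat_l _ _ _ d0 dq; lra.
(* Ensures that the natural-number subtractions do not truncate. *)
have sub1 : (K + 3 * (d * d) <= q * d)%N.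
  by apply: leq_INR; rewrite INR_addn !INR_muln; simpl INR; nra.
set s := (q * d - k)%N; set r := (s - 3 * (d * d))%N.
apply: leq_INR; rewrite INR_addn !INR_muln.
have sE : INR s + INR k = INR q * INR d by rewrite -INR_addn -INR_muln; congr INR; lia.
have rE : INR r + 3 * (INR d * INR d) = INR s.
  by replace 3 with (INR 3) by (simpl INR; lra); rewrite -!INR_muln -INR_addn; congr INR; lia.
have kR : INR k <= INR K by apply/INR_leq/ltnW.
have Knd := Rmult_le_compat_l _ _ _ d0 Kn.
have u0 : 0 <= INR d * INR q - INR K - 3 * (INR d * INR d) by nra.
(* Both factors decrease in [k], so [k = K] is the worst case. *)
apply: (Rle_trans _ ((INR d * INR q - INR K) *
  (INR d * INR q - INR K - 3 * (INR d * INR d)))); last first.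
  by apply: Rmult_le_compat; nra.
(* After expansion [K^2] cancels and [K n d <= (1 - eta) (d q)^2]; what remains is nonnegative
   because [2 K] and [3 d^2] are each at most [eta d q / 2]. *)
have h : 0 <= INR d * INR q * (eta * (INR d * INR q) - 2 * INR K - 3 * (INR d * INR d)).
  by apply: Rmult_le_pos; lra.
have : 0 <= INR K * (3 * (INR d * INR d)) by nra.
nra.
Qed.

Lemma nat_ceil (x : R) : 0 <= x -> exists k : nat, x <= INR k < x + 1.
Proof.
move=> x0; have [h1 h2] := archimed (- x).
have k0 : (0 <= 1 - up (- x))%Z.
  suff : (up (- x) < 2)%Z by lia.
  by apply: lt_IZR; lra.
exists (Z.to_nat (1 - up (- x))).
by rewrite INR_IZR_INZ Z2Nat.id // minus_IZR; lra.
Qed.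

Lemma nat_floor (x : R) : 0 <= x -> exists k : nat, INR k <= x < INR k + 1.
Proof.
move=> x0; have [h1 h2] := archimed x.
have k0 : (0 <= up x - 1)%Z.
  suff : (0 < up x)%Z by lia.
  by apply: lt_IZR; lra.
exists (Z.to_nat (up x - 1)).
by rewrite INR_IZR_INZ Z2Nat.id // minus_IZR; lra.
Qed.

(** The choice of the two sets costs [exp (2 q + 2 q L)]. The relation of [eta] to [eps] says
    [2 (1 + eps) (1 - eta) = 2 + eps], so [K] can be taken above [(2 + eps) L q - 1], and
    [3 <= eps L] leaves a factor at most [exp (1 - q)]. It beats the factor linear in [K] once [n]
    is large in terms of [d] and [delta]. *)
Lemma card_hole_graphs_small (eps eta delta L : R) n d q :
  0 < eps -> 0 < eta -> 2 * (1 + eps) * eta = eps -> L = ln (INR d) ->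
  0 < INR d -> 1 <= L -> 3 <= eps * L -> 16 * (1 + eps) * L <= eta * INR d ->
  8 <= eta * INR n -> 6 * (INR d * INR d) <= eta * INR n ->
  8 * (exp 1 * exp 1) * (INR d * INR d) <= delta * INR n ->
  (1 + eps) * (2 * INR n * L / INR d) <= INR q <
  (1 + eps) * (2 * INR n * L / INR d) + 1 ->
  INR #|hole_graphs n d q| <= delta * INR #|Gnd n d|.
Proof.
move=> eps0 eta0 etaE LE d0 L1 epsL Ld n8 nd2 nde.
set t := _ * (_ / _) => -[tq qt].
have eta1 : eta < / 2 by nra.
have n0 : 0 < INR n by nra.
have nN : (0 < n)%N by apply/ltP/INR_lt.
have td : t * INR d = 2 * (1 + eps) * L * INR n by rewrite /t; field; lra.
(* The unrounded [t] is at most [eta n / 8], and [8 <= eta n] absorbs the rounding up. *)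
have q4 : INR q <= eta / 4 * INR n.
  suff : t <= eta / 8 * INR n by lra.
  by apply: (Rmult_le_reg_r (INR d)) => //; rewrite td; nra.
have dqn : 2 * (1 + eps) * L * INR n <= INR d * INR q by rewrite -td; nra.
have nqd : INR n <= INR d * INR q.
  have : 1 <= 2 * (1 + eps) * L by nra.
  by nra.
have q0 : 0 < INR q by nra.
have q6 : 6 * INR d <= eta * INR q.
  apply: (Rmult_le_reg_r (INR d)) => //; nra.
have qN : 1 <= INR q by apply: (@INR_leq 1); apply/ltP/INR_lt.
(* [1 - eta] times the mean number of crossing edges; [K] will be its floor. *)
pose x := (1 - eta) * INR d * INR q * INR q / INR n.
have xE : x * INR n = (1 - eta) * INR d * INR q * INR q by rewrite /x; field; lra.
have xge : (2 + eps) * L * INR q <= x.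
  apply: (Rmult_le_reg_r (INR n)) => //; rewrite xE.
  have h : 0 <= (1 - eta) * INR q by nra.
  have := Rmult_le_compat_l _ _ _ h dqn.
  by replace ((1 - eta) * INR q * (2 * (1 + eps) * L * INR n)) with
    ((2 * (1 + eps) - 2 * (1 + eps) * eta) * L * INR q * INR n) by ring; rewrite etaE; lra.
have x0 : 0 <= x by nra.
have [K [Kx xK]] := nat_floor x0.
have xge2 : 2 * L * INR q + 3 * INR q <= x by nra.
have KN : (0 < K)%N by apply/ltP/INR_lt; rewrite /=; nra.
have Kn : INR K * INR n <= (1 - eta) * INR d * INR q * INR q by rewrite -xE; nra.
have Kdq : INR K <= INR d * INR q.
  apply: (Rmult_le_reg_r (INR n)) => //; apply: (Rle_trans _ _ _ Kn).
  have : 0 <= INR d * INR q by nra.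
  have : INR q <= INR n by nra.
  by nra.
have FK := switching_threshold (conj eta0 (ltac:(lra) : eta <= 1)) nN Kn q4 q6.
have nqdN : (n <= q * d)%N by apply: leq_INR; rewrite INR_muln; lra.
have G0 := pos_INR #|Gnd n d|.
apply: (Rle_trans _ _ _ (card_hole_graphs_le KN nqdN FK)); rewrite Rmult_comm.
apply: Rmult_le_compat_r => //.
have -> : INR d ^ q = exp (INR q * L) by rewrite LE -exp_natmul exp_ln.
rewrite -exp_plus exp_natmul; simpl INR.
set E := exp _.
have E0 : 0 < E by exact: exp_pos.
have EK : E * exp (- INR K) <= exp 1 * exp (- INR q).
  rewrite /E -!exp_plus; set u := (X in exp X <= _); set v := (X in _ <= exp X).
  have : u <= v by rewrite /u /v; lra.
  by case=> [/exp_increasing|->]; [lra|exact: Rle_refl].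
have e1 := exp_pos 1; have eq0 := exp_pos (- INR q); have eK := exp_pos (- INR K).
apply: (Rle_trans _ (2 * exp 1 * (INR d * INR q) * (exp 1 * exp (- INR q)))).
  replace (E * _) with (2 * exp 1 * INR K * (E * exp (- INR K))) by ring.
  have := pos_INR K => K0.
  by apply: Rmult_le_compat => //; nra.
have qe : INR q * exp (- INR q) * INR q <= 4.
  have := sqr_le_exp (Rlt_le _ _ q0) => /(Rmult_le_compat_r _ _ _ (Rlt_le _ _ eq0)).
  by rewrite [4 * _ * _]Rmult_assoc -exp_plus Rplus_opp_r exp_0; lra.
(* After this multiplication the left side is [2 e^2 d^2 q^2 exp (- q) <= 8 e^2 d^2 <= delta n], and
   [n <= d q]. *)
apply: (Rmult_le_reg_r (INR d * INR q)); first by nra.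
have dn : delta * INR n <= delta * (INR d * INR q).
  apply: Rmult_le_compat_l => //.
  have : 0 <= 8 * (exp 1 * exp 1) * (INR d * INR d) by nra.
  by nra.
have := Rmult_le_compat_l (2 * (exp 1 * exp 1) * (INR d * INR d)) _ _ ltac:(nra) qe.
lra.
Qed.

(** * Constants depending on [eps], and the limit in [n] *)

Lemma large_params eps : 0 < eps -> exists eta M : R,
  [/\ 0 < eta, 2 * (1 + eps) * eta = eps & forall d, 0 < INR d -> M <= ln (INR d) ->
   [/\ 1 <= ln (INR d), 3 <= eps * ln (INR d)
     & 16 * (1 + eps) * ln (INR d) <= eta * INR d]].
Proof.
move=> eps0; pose eta := eps / (2 * (1 + eps)).
have eta0 : 0 < eta by apply: Rdiv_lt_0_compat; lra.
(* Each summand gives one of the bounds. For the last, [64 (1 + eps) <= eta L] is multiplied by [L]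
   and combined with [L^2 <= 4 d]. *)
exists eta, (1 + 3 / eps + 64 * (1 + eps) / eta); split=> //.
  by rewrite /eta; field; lra.
move=> d d0; set L := ln _ => ML.
have h1 : 0 < 3 / eps by apply: Rdiv_lt_0_compat; lra.
have h2 : 0 < 64 * (1 + eps) / eta by apply: Rdiv_lt_0_compat; lra.
have L1 : 1 <= L by lra.
split=> //.
  have : eps * (3 / eps) <= eps * L by apply: Rmult_le_compat_l; lra.
  by replace (eps * (3 / eps)) with 3 by (field; lra).
have : eta * (64 * (1 + eps) / eta) <= eta * L by apply: Rmult_le_compat_l; lra.
replace (eta * (64 * (1 + eps) / eta)) with (64 * (1 + eps)) by (field; lra).
move=> h; have : L * L <= 4 * INR d.
  by rewrite -[INR d]exp_ln //; apply: sqr_le_exp; rewrite -/L; lra.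
move=> /(Rmult_le_compat_l eta _ _ (Rlt_le _ _ eta0)).
have := Rmult_le_compat_r L _ _ ltac:(lra) h; lra.
Qed.

(** Both conclusions of the theorem rest on a single size [q] per [n], the rounded-up threshold. [M]
    precedes [d], so it determines [d0]; [C] lets a caller ask for larger [n]. *)
Lemma aas_no_hole eps : 0 < eps -> exists M : R,
  forall d, 0 < INR d -> M <= ln (INR d) -> 1 <= ln (INR d) /\
  forall delta C : R, 0 < delta ->
  exists N : nat, forall n, (N <= n)%N -> C <= INR n /\
    exists (q : nat) (S : {set graph n}),
      (1 + eps) * (2 * INR n * ln (INR d) / INR d) <= INR q <
        (1 + eps) * (2 * INR n * ln (INR d) / INR d) + 1 /\
      S \subset Gnd n d /\ (1 - delta) * INR #|Gnd n d| <= INR #|S| /\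
      forall G, G \in S -> ~ bip_hole G q.
Proof.
move=> eps0; have [eta [M [eta0 etaE params]]] := large_params eps0.
exists M => d d0 /(params d d0)[L1 epsL Ld]; split=> //.
move=> delta C delta0.
set L := ln _ in L1 epsL Ld *.
(* Lower bounds on [n] for the three size conditions; an [n] above their sum meets all of them. *)
pose a := 8 / eta; pose b := 6 * (INR d * INR d) / eta.
pose c := 8 * (exp 1 * exp 1) * (INR d * INR d) / delta.
have e1 := exp_pos 1.
have a0 : 0 <= a by apply/Rlt_le/Rdiv_lt_0_compat; lra.
have b0 : 0 <= b by apply/Rlt_le/Rdiv_lt_0_compat; nra.
have dd : 0 < INR d * INR d by nra.
have ee : 0 < 8 * (exp 1 * exp 1) by nra.
have c0 : 0 <= c by apply/Rlt_le/Rdiv_lt_0_compat => //; exact: Rmult_lt_0_compat.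
have abc0 : 0 <= Rabs C + a + b + c by have := Rabs_pos C; lra.
have [N [Nge _]] := nat_ceil abc0.
exists N => n /INR_leq Nn.
have CC := Rle_abs C; have C0 := Rabs_pos C.
split; first by lra.
have le_eta y z w : 0 < w -> y = z / w -> y <= INR n -> z <= w * INR n.
  move=> w0 -> /(Rmult_le_compat_l w _ _ (Rlt_le _ _ w0)).
  by replace (w * (z / w)) with z by (field; lra).
have t0 : 0 <= (1 + eps) * (2 * INR n * L / INR d).
  apply: Rmult_le_pos; first lra.
  by apply: Rmult_le_pos; [have := pos_INR n; nra|apply/Rlt_le/Rinv_0_lt_compat].
have [q tq] := nat_ceil t0.
have hole := card_hole_graphs_small eps0 eta0 etaE (erefl L) d0 L1 epsL Ld
  (le_eta a _ _ eta0 erefl ltac:(lra)) (le_eta b _ _ eta0 erefl ltac:(lra))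
  (le_eta c _ _ delta0 erefl ltac:(lra)) tq.
exists q, (Gnd n d :\: hole_graphs n d q); split=> //; split; first exact: subsetDl.
split.
  have := cardsID (hole_graphs n d q) (Gnd n d) => /(congr1 INR).
  have := INR_leq (subset_leq_card (subsetIr (Gnd n d) (hole_graphs n d q))).
  by rewrite INR_addn; lra.
by move=> G; rewrite inE => /andP[GH GG] /(bip_hole_hole_graphs GG); rewrite (negPf GH).
Qed.

Theorem mainTheorem2 :
  forall eps : R, (0 < eps)%R ->
  exists d0 : nat, forall d : nat, (d0 <= d)%N ->
    aas d (fun n G => forall q : nat,
             ((1 + eps) * (2 * INR n * ln (INR d) / INR d) <= INR q)%R ->
             ~ bip_hole G q)
    /\
    aas d (fun n G =>
             Z_ge G (INR n * (1 - (1 + eps) * (4 * ln (INR d) / INR d)))%R).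
Proof.
move=> eps eps0; have eps2 : 0 < eps / 2 by lra.
have [M1 H1] := aas_no_hole eps0; have [M2 H2] := aas_no_hole eps2.
have [d0 [d0M _]] := nat_ceil (Rlt_le _ _ (exp_pos (Rmax M1 M2))).
exists d0 => d /INR_leq dd0.
have dpos : 0 < INR d by have := exp_pos (Rmax M1 M2); lra.
have lnd : Rmax M1 M2 <= ln (INR d).
  by apply: Rnot_lt_le => /exp_increasing; rewrite exp_ln //; lra.
have /(H1 _ dpos)[L1 {}H1] : M1 <= ln (INR d) by have := Rmax_l M1 M2; lra.
have /(H2 _ dpos)[_ {}H2] : M2 <= ln (INR d) by have := Rmax_r M1 M2; lra.
set L := ln _ in L1 H1 H2 *.
split=> delta delta0.
  have [N HN] := H1 delta 0 delta0; exists N => n Nn _.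
  have [_ [q [S [[_ qt] [SG [cS noS]]]]]] := HN n Nn.
  exists S; split=> //; split=> // G GS q' tq' hole'; apply: (noS G GS).
  (* [q] is less than the threshold plus one and [q'] is at least the threshold, so [q <= q']. *)
  apply: bip_hole_leq hole'; rewrite -ltnS; apply/ltP/INR_lt.
  by rewrite S_INR; lra.
have [N HN] := H2 delta (INR d / eps) delta0; exists N => n Nn _.
have [nd [q [S [[_ qt] [SG [cS noS]]]]]] := HN n Nn.
exists S; split=> //; split=> // G GS B ZB.
apply: Rnot_lt_le => Bn; apply: (noS G GS); apply: (zero_forcing_bip_hole ZB).
apply: leq_INR; rewrite -muln2 INR_addn INR_muln; simpl INR.
(* From [n >= d / eps] and [L >= 1]. Rounding adds less than 2 to [2 q], hence less than
   [2 eps n L / d], the gap between the coefficients [4 + 2 eps] and [4 + 4 eps]. *)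
have slack : 1 <= eps * (INR n * L / INR d).
  have : INR d <= eps * INR n.
    have := Rmult_le_compat_l eps _ _ (Rlt_le _ _ eps0) nd.
    by replace (eps * (INR d / eps)) with (INR d) by (field; lra).
  move=> h; apply: (Rmult_le_reg_r (INR d)) => //.
  replace (eps * (INR n * L / INR d) * INR d) with (eps * INR n * L) by (field; lra).
  nra.
have e1 : (1 + eps / 2) * (2 * INR n * L / INR d) =
    (2 + eps) * (INR n * L / INR d) by field; lra.
have e2 : INR n * (1 - (1 + eps) * (4 * L / INR d)) =
    INR n - 4 * (1 + eps) * (INR n * L / INR d) by field; lra.
move: Bn qt; rewrite e1 e2 => Bn qt.
apply: (Rle_trans _ _ _ (Rplus_le_compat_r _ _ _ (Rlt_le _ _ Bn))); lra.
Qed.
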